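(* (i) For all integers $n\ge1$ and complex $q$ and $\beta\notin\{1,q^{-1},q^{-2},\ldots\}$, $$0=\sum_{k=0}^n(-1)^kq^{\binom k2}\begin{bmatrix}n\\ k\end{bmatrix}_q(\beta q^{n-k})_{n-1},$$ $$0=\sum_{k=0}^n(-1)^kq^{\binom k2}\begin{bmatrix}n\\ k\end{bmatrix}_q\frac{1-\beta q^{2k}}{(\beta q^k)_{n+1}},$$ and, for $\beta\neq0$, $$0=\sum_{j=0}^n\begin{bmatrix}n\\ j\end{bmatrix}_q(\beta)_j\,\beta^{n-j}(\beta^{-1})_{n-j}.$$ (ii) For all $|\beta|,|q|<1$, $$\frac{(\beta,\beta q)_\infty(-\beta)_\infty^2}{(\beta^2)_\infty}=\sum_{n\ge0}\beta^nq^{\binom n2}\frac{(\beta)_n(1-\beta q^{2n})(q)_{2n}(\beta^2|q^2)_n}{(q)_n(\beta^2)_{2n}(1-\beta)(q^2|q^2)_n},$$ $$\frac{(\beta^2)_\infty}{(\beta,\beta q)_\infty(-\beta)_\infty^2}=\sum_{n\ge0}(-\beta)^n\frac{(1-\beta)(q|q^2)_n}{(q)_n(\beta)_{n+1}} .$$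
   Context: $(a|q)_n=\prod_{j=0}^{n-1}(1-aq^j)$, $(a|q)_\infty=\prod_{j\ge0}(1-aq^j)$; $(a)_n$ abbreviates $(a|q)_n$ and $(a,b)_n=(a)_n(b)_n$ (also for $n=\infty$). $\begin{bmatrix}n\\ k\end{bmatrix}_q$ is the Gauss ($q$-binomial) polynomial, equal to $\frac{(q)_n}{(q)_k(q)_{n-k}}$ when the denominator does not vanish. *)

(* Defs.v *)
From mathcomp Require Import all_boot all_order all_algebra ring.
From mathcomp Require Import all_classical all_reals all_analysis.
From mathcomp Require Export complex.

Set Implicit Arguments.
Unset Strict Implicit.
Unset Printing Implicit Defensive.

Import Order.TTheory GRing.Theory Num.Theory.
Import numFieldNormedType.Exports.

Local Open Scope classical_set_scope.
Local Open Scope ring_scope.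
Local Open Scope complex_scope.

(* (a|q)_n *)
Definition qpoch (F : fieldType) (a q : F) (n : nat) : F :=
  \prod_(j < n) (1 - a * q ^+ j).

(* (a|q)_oo, as the limit of the partial products; they converge as soon as
   |q| < 1.  The regular module R[i]^o carries the topology of the norm. *)
Definition qpoch_inf (R : realType) (a q : R[i]) : R[i] :=
  lim ((fun n => qpoch a q n : R[i]^o) @ \oo).

(* The Gauss polynomial evaluated at q, through the q-Pascal rule
   [n+1, k+1] = [n, k] + q^(k+1) [n, k+1], so that no division is involved and
   roots of unity are allowed; qbinomE is the quotient formula. *)
Fixpoint qbinom (F : fieldType) (q : F) (n k : nat) : F :=
  match n, k with
  | _, 0%N => 1
  | 0%N, _.+1 => 0
  | n'.+1, k'.+1 => qbinom q n' k' + q ^+ k'.+1 * qbinom q n' k'.+1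
  end.

Lemma qpochS (F : fieldType) (a q : F) (n : nat) :
  qpoch a q n.+1 = qpoch a q n * (1 - a * q ^+ n).
Proof. by rewrite /qpoch big_ord_recr. Qed.

Lemma qbinom_small (F : fieldType) (q : F) (n k : nat) :
  (n < k)%N -> qbinom q n k = 0.
Proof.
elim: n k => [|n IHn] [|k] //= ltnk.
by rewrite !IHn ?mulr0 ?addr0 // ltnW.
Qed.

Lemma qbinom_mul (F : fieldType) (q : F) (n k : nat) : (k <= n)%N ->
  qbinom q n k * (qpoch q q k * qpoch q q (n - k)) = qpoch q q n.
Proof.
elim: n k => [|n IHn] [|k] //=.
- by rewrite /qpoch !big_ord0 !mulr1.
- by rewrite subn0 /qpoch big_ord0 !mul1r.
rewrite ltnS subSS leq_eqVlt => /predU1P[->|ltkn].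
  rewrite (qbinom_small q (ltnSn n)) mulr0 addr0 qpochS.
  by rewrite mulrAC mulrA (IHn _ (leqnn n)).
have E1 := IHn _ (ltnW ltkn); have E2 := IHn _ ltkn.
have En : q ^+ n = q ^+ k * q * q ^+ (n - k.+1).
  by rewrite -exprSr -exprD subnKC.
move: E1 E2; rewrite -(subnSK ltkn) !qpochS En exprS => E1 E2.
set A := qbinom q n k in E1 *; set B := qbinom q n k.+1 in E2 *.
set K := qpoch q q k in E1 E2 *; set M := qpoch q q (n - k.+1) in E1 E2 *.
set x := q ^+ k in E1 E2 *; set y := q ^+ (n - k.+1) in E1 E2 *.
transitivity ((1 - q * x) * (A * (K * (M * (1 - q * y))))
              + q * x * (1 - q * y) * (B * (K * (1 - q * x) * M))); first by ring.
by rewrite E1 E2; ring.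
Qed.

Lemma qbinomE (F : fieldType) (q : F) (n k : nat) : (k <= n)%N ->
  qpoch q q k * qpoch q q (n - k) != 0 ->
  qbinom q n k = qpoch q q n / (qpoch q q k * qpoch q q (n - k)).
Proof. by move=> lekn nz; rewrite -(qbinom_mul q lekn) mulfK. Qed.

(* Main.v *)
(* The finite sums.  The second and third are Gosper-summable: their partial
   sums have a closed form containing a Gauss polynomial that vanishes at the
   upper end.  The first follows by induction on n, since by the q-Pascal rule
   the alternating sum of f for n + 1 is that of q^k (f k - f (k + 1)) for n.

   The series.  In terms of square roots of q, the second series is the
   2phi1(sqrt q, - sqrt q; beta q; q, - beta) of the q-Gauss sum, and the first
   is the limit d -> oo of a very-well-poised 6phi5 with parameters
   beta, sqrt q, - sqrt q, d.  A rational (WZ) certificate relates the partial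
   sums at x and at x q, S_N(x) = c(x) S_N(x q) - g_N(x), with g_N(x) = O(|x|^N)
   uniformly for |x| <= |beta|.  Iterating this N times and using
   S_N(x) = 1 + O(|x|), S_N(beta) differs from the finite product of the
   c(beta q^i), i < N, by O(|q|^N + |beta|^N), and that product converges to
   the claimed quotient of infinite products. *)
Require Import Defs.
From mathcomp Require Import all_boot all_order all_algebra ring.
From mathcomp Require Import all_classical all_reals all_analysis.

Set Implicit Arguments.
Unset Strict Implicit.
Unset Printing Implicit Defensive.

Import Order.TTheory GRing.Theory Num.Theory.
Import numFieldNormedType.Exports.

Local Open Scope classical_set_scope.
Local Open Scope ring_scope.
Local Open Scope complex_scope.

(** * Shifted factorials and ratios of Gauss polynomials *)

Lemma qpoch0 (F : fieldType) (a q : F) : qpoch a q 0 = 1.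
Proof. exact: big_ord0. Qed.

Lemma qpochSl (F : fieldType) (a q : F) (n : nat) :
  qpoch a q n.+1 = (1 - a) * qpoch (a * q) q n.
Proof.
rewrite /qpoch big_ord_recl expr0 mulr1; congr (_ * _).
by apply: eq_bigr => i _; rewrite exprS mulrA.
Qed.

Lemma qpoch_neq0 (F : fieldType) (a q : F) (n : nat) :
  (forall j, 1 - a * q ^+ j != 0) -> qpoch a q n != 0.
Proof. by move=> nz; apply/prodf_neq0 => j _. Qed.

Lemma qpoch_double (F : fieldType) (a q : F) (n : nat) :
  qpoch a q (2 * n) = qpoch a (q ^+ 2) n * qpoch (a * q) (q ^+ 2) n.
Proof.
elim: n => [|n IHn]; first by rewrite muln0 !qpoch0 mulr1.
rewrite mulnS add2n !qpochS {}IHn -!exprM [q ^+ (2 * n).+1]exprS.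
by ring.
Qed.

Lemma qpoch_sqr (F : fieldType) (a q : F) (n : nat) :
  qpoch (a ^+ 2) (q ^+ 2) n = qpoch a q n * qpoch (- a) q n.
Proof.
elim: n => [|n IHn]; first by rewrite !qpoch0 mulr1.
by rewrite !qpochS {}IHn -!exprM mulnC exprM; ring.
Qed.

(** The ratio of consecutive Gauss polynomials with denominators cleared, so that it follows from
    the q-Pascal rule and holds at roots of unity. The telescoping of the second and third finite
    sums rests on it. *)
Lemma qbinom_shift (F : fieldType) (q : F) (n k : nat) :
  qbinom q n k.+1 * (1 - q ^+ k.+1) = qbinom q n k * (1 - q ^+ (n - k)).
Proof.
elim: n k => [|n IHn] [|k] /=; try by rewrite ?subrr ?mulr0 ?mul0r.
  have := IHn 0%N; rewrite subn0 expr1 => E.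
  have -> : qbinom q n 0 = 1 by case: (n).
  have {}E : qbinom q n 1 * (1 - q) = 1 - q ^+ n.
    by rewrite E; case: (n) => [|?]; rewrite mul1r.
  by rewrite mulrDl -mulrA E subn0 exprS; ring.
have [ltkn|lenk] := ltnP k n; last first.
  have -> : qbinom q n k.+1 = 0 by apply: qbinom_small.
  have -> : qbinom q n k.+2 = 0 by apply: qbinom_small; apply: leqW.
  have -> : (n.+1 - k.+1 = 0)%N by apply/eqP; rewrite subn_eq0.
  by rewrite expr0 subrr !mulr0 addr0 mul0r.
have En : q ^+ (n - k) = q * q ^+ (n - k.+1) by rewrite -exprS subnSK.
rewrite subSS mulrDl -mulrA (IHn k.+1) [RHS]mulrDl -(IHn k) En [q ^+ k.+2]exprS.
by ring.
Qed.

(** * The first finite sum *)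

(** Split by the q-Pascal rule and shift the index in the half containing [n, k - 1]. The factor q^k
    comes from C(k + 1, 2) = C(k, 2) + k in that half, and from the rule itself in the other. *)
Lemma qbinom_alt_sumS (F : fieldType) (q : F) (n : nat) (f : nat -> F) :
  \sum_(k < n.+2) (-1) ^+ k * q ^+ 'C(k, 2) * qbinom q n.+1 k * f k =
  \sum_(k < n.+1) (-1) ^+ k * q ^+ 'C(k, 2) * qbinom q n k
                  * (q ^+ k * (f k - f k.+1)).
Proof.
have E k : qbinom q n.+1 k =
  (if k is k'.+1 then qbinom q n k' else 0) + q ^+ k * qbinom q n k.
  by case: k => [|k] //=; case: (n) => [|?]; rewrite add0r mulr1.
under eq_bigr => k _ do rewrite E mulrDr mulrDl.
rewrite big_split /= big_ord_recl /= mulr0 mul0r add0r.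
rewrite [X in _ + X]big_ord_recr /= (qbinom_small q (ltnSn n)).
rewrite !mulr0 mul0r addr0.
rewrite -big_split /=; apply: eq_bigr => k _.
by rewrite /bump /= add1n binS bin1 exprD exprS; ring.
Qed.

Lemma qbinom_alt_qpoch_sum (F : fieldType) (q b : F) (n : nat) :
  \sum_(k < n.+2) (-1) ^+ k * q ^+ 'C(k, 2) * qbinom q n.+1 k
                  * qpoch (b * q ^+ (n.+1 - k)) q n = 0.
Proof.
elim: n b => [|n IHn] b.
  by rewrite !big_ord_recl big_ord0 /= !qpoch0 expr1; ring.
transitivity (\sum_(k < n.+2) (-1) ^+ k * q ^+ 'C(k, 2) * qbinom q n.+1 k
    * (q ^+ k * (qpoch (b * q ^+ (n.+2 - k)) q n.+1
                 - qpoch (b * q ^+ (n.+2 - k.+1)) q n.+1))).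
  exact: (qbinom_alt_sumS q n.+1 (fun k => qpoch (b * q ^+ (n.+2 - k)) q n.+1)).
(* The two products share n factors, and the prefactor [q ^+ k] makes what remains of their
   difference independent of k. The induction hypothesis then applies with [b * q] in place of
   [b]. *)
transitivity (\sum_(k < n.+2) b * q ^+ n.+1 * (1 - q ^+ n.+1) *
   ((-1) ^+ k * q ^+ 'C(k, 2) * qbinom q n.+1 k
                  * qpoch (b * q * q ^+ (n.+1 - k)) q n)).
  apply: eq_bigr => k _.
  have le_kn : (k <= n.+1)%N by rewrite -ltnS.
  rewrite subSS (subSn le_kn) [qpoch _ q n.+1 in X in _ - X]qpochSl.
  have -> : b * q ^+ n.+1 = b * (q ^+ k * q ^+ (n.+1 - k)).
    by rewrite -exprD subnKC.
  rewrite qpochS.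
  have -> : b * q ^+ (n.+1 - k).+1 = b * q * q ^+ (n.+1 - k).
    by rewrite exprS mulrA.
  have -> : b * q ^+ (n.+1 - k) * q = b * q * q ^+ (n.+1 - k) by ring.
  by rewrite [q ^+ n.+1 in RHS]exprS; ring.
by rewrite -mulr_sumr IHn mulr0.
Qed.

(** * The second finite sum *)

(** The extra [q ^+ k.+1] absorbs the truncated exponent [n - k] of [qbinom_shift], leaving powers
    that [ring] can compare. *)
Lemma qbinom_shiftM (F : fieldType) (q : F) (n k : nat) :
  q ^+ k.+1 * qbinom q n k.+1 * (1 - q ^+ k.+1) =
  qbinom q n k * (q ^+ k.+1 - q ^+ n.+1).
Proof.
rewrite -mulrA qbinom_shift.
have [lekn|ltnk] := leqP k n; last by rewrite qbinom_small // !mul0r mulr0.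
have -> : q ^+ n.+1 = q ^+ k.+1 * q ^+ (n - k) by rewrite -exprD addSn subnKC.
by ring.
Qed.

(** Induction on K. The closed form carries [m, K] where the summand carries [m + 1, k], so it
    vanishes at K = m + 1, exactly when the sum is complete. *)
Lemma qbinom_wellpoised_partial_sum (F : fieldType) (q b : F) (m K : nat) :
  (forall j, 1 - b * q ^+ j != 0) ->
  \sum_(k < K.+1) (-1) ^+ k * q ^+ 'C(k, 2) * qbinom q m.+1 k
      * ((1 - b * q ^+ (2 * k)) / qpoch (b * q ^+ k) q m.+2)
  = (-1) ^+ K * q ^+ 'C(K.+1, 2) * qbinom q m K / qpoch (b * q ^+ K.+1) q m.+1.
Proof.
move=> nz.
have nzq k n : qpoch (b * q ^+ k) q n != 0.
  by apply: qpoch_neq0 => j; rewrite -mulrA -exprD.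
elim: K => [|K IHK].
  rewrite big_ord1 /= muln0 !expr0 !mulr1 expr1 qpochSl.
  have -> : qbinom q m 0 = 1 by case: (m).
  have := nz 0%N; have := nzq 1%N m.+1; rewrite expr1 expr0 mulr1 => nzP nzb.
  by field; rewrite nzP.
rewrite big_ord_recr {}IHK.
have nz1 := nz K.+1; have nz2 := nz (K.+1 + m.+1)%N.
have E1 : qpoch (b * q ^+ K.+1) q m.+1 =
          (1 - b * q ^+ K.+1) * qpoch (b * q ^+ K.+2) q m.
  by rewrite qpochSl -mulrA -exprSr.
have E2 : qpoch (b * q ^+ K.+2) q m.+1 =
          qpoch (b * q ^+ K.+2) q m * (1 - b * q ^+ (K.+1 + m.+1)).
  by rewrite qpochS -mulrA -exprD addSnnS.
have E0 : qpoch (b * q ^+ K.+1) q m.+2 =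
          qpoch (b * q ^+ K.+1) q m.+1 * (1 - b * q ^+ (K.+1 + m.+1)).
  by rewrite qpochS -mulrA -exprD.
rewrite E0 E1 E2.
have := nzq K.+2 m; set P := qpoch _ _ _ => nzP.
(* The content of the induction step, linear in b: the part free of b is the q-Pascal rule, and the
   coefficient of b reduces to [qbinom_shiftM]. *)
have EX : (1 - b * q ^+ (2 * K.+1)) * qbinom q m.+1 K.+1 =
    q ^+ K.+1 * qbinom q m K.+1 * (1 - b * q ^+ K.+1)
    + qbinom q m K * (1 - b * q ^+ (K.+1 + m.+1)).
  apply/eqP; rewrite -subr_eq0; apply/eqP.
  transitivity (b * q ^+ K.+1 * (q ^+ K.+1 * qbinom q m K.+1 * (1 - q ^+ K.+1)
                - qbinom q m K * (q ^+ K.+1 - q ^+ m.+1))).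
    by rewrite /= mulnC exprM exprD; ring.
  by rewrite qbinom_shiftM subrr mulr0.
have assoc (s u v w : F) : s * u * (v / w) = s * (v * u) / w by ring.
have EC : q ^+ 'C(K.+2, 2) = q ^+ 'C(K.+1, 2) * q ^+ K.+1.
  by rewrite binS bin1 exprD.
rewrite assoc EX EC -[nat_of_ord ord_max]/K.+1; set c := q ^+ 'C(K.+1, 2).
move: nz2; rewrite exprD [(-1) ^+ K.+1]exprS /= => nz2.
by field; rewrite nz2 nzP nz1.
Qed.

(** * The third finite sum *)

(** The products of b - q^i are a division-free form of b^n (b^-1)_n, by [exprM_qpochV]. Each step
    of the induction on K is an instance of [qbinom_shift], and [m, K] again vanishes at K = m +
    1. *)
Lemma qbinom_qpoch_partial_sum (F : fieldType) (q b : F) (m K : nat) :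
  (K <= m.+1)%N ->
  \sum_(j < K.+1) qbinom q m.+1 j * qpoch b q j
                  * \prod_(i < m.+1 - j) (b - q ^+ i)
  = qbinom q m K * qpoch (b * q) q K * \prod_(i < m.+1 - K) (b - q ^+ i).
Proof.
elim: K => [_|K IHK leKm].
  by rewrite big_ord1 !qpoch0 /=; case: (m).
rewrite big_ord_recr {}IHK ?(ltnW leKm) //=.
rewrite subSS (subSn (_ : K <= m)%N) // [in LHS]big_ord_recr /=.
rewrite qpochSl qpochS.
set P := qpoch _ _ _; set B := \prod_(i < _) _.
apply/eqP; rewrite -subr_eq0; apply/eqP.
transitivity (B * P * (qbinom q m K * (1 - q ^+ (m - K))
                       - qbinom q m K.+1 * (1 - q ^+ K.+1))).
  by rewrite !exprS; ring.
by rewrite qbinom_shift subrr mulr0.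
Qed.

Lemma exprM_qpochV (F : fieldType) (q b : F) (n : nat) : b != 0 ->
  b ^+ n * qpoch b^-1 q n = \prod_(i < n) (b - q ^+ i).
Proof.
move=> nzb; elim: n => [|n IHn]; first by rewrite qpoch0 big_ord0 mulr1.
rewrite big_ord_recr /= -IHn qpochS exprSr.
transitivity (b ^+ n * qpoch b^-1 q n * (b - b * b^-1 * q ^+ n)); first by ring.
by rewrite divff // mul1r.
Qed.

(** * Summands of the two series and their recurrences in x *)

(* wp_cert is, up to the factor 1 - q^n, the WZ certificate of wp_term. *)
Definition wp_cert (F : fieldType) (q x : F) (n : nat) : F :=
  x ^+ n * q ^+ 'C(n, 2) * (qpoch x q n * qpoch q (q ^+ 2) n
    / ((1 - x) * qpoch q q n * qpoch (x ^+ 2 * q) (q ^+ 2) n)).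

Definition wp_term (F : fieldType) (q x : F) (n : nat) : F :=
  wp_cert q x n * (1 - x * q ^+ (2 * n)).

(** The summand of the second series with 1 - x cancelled; (q|q^2)_n is the product of (sqrt q)_n
    and (- sqrt q)_n. *)
Definition gauss_term (F : fieldType) (q x : F) (n : nat) : F :=
  (- x) ^+ n * (qpoch q (q ^+ 2) n / (qpoch q q n * qpoch (x * q) q n)).

Lemma qpoch_shift (F : fieldType) (a q : F) (n : nat) : 1 - a != 0 ->
  qpoch (a * q) q n = qpoch a q n * (1 - a * q ^+ n) / (1 - a).
Proof. by move=> nza; rewrite -qpochS qpochSl mulrAC divff ?mul1r. Qed.

(** Splitting (q)_{2n} and (x^2)_{2n} by the parity of the index cancels (q^2|q^2)_n and
    (x^2|q^2)_n. *)
Lemma wp_termE (F : fieldType) (q x : F) (n : nat) :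
  1 - x != 0 -> qpoch q q n != 0 -> qpoch q q (2 * n) != 0 ->
  qpoch (x ^+ 2) q (2 * n) != 0 ->
  wp_term q x n = x ^+ n * q ^+ 'C(n, 2)
    * ((qpoch x q n * (1 - x * q ^+ (2 * n))
        * qpoch q q (2 * n) * qpoch (x ^+ 2) (q ^+ 2) n)
       / (qpoch q q n * qpoch (x ^+ 2) q (2 * n)
          * (1 - x) * qpoch (q ^+ 2) (q ^+ 2) n)).
Proof.
move=> nz0 nz1; rewrite !qpoch_double -expr2 !mulf_eq0 !negb_or.
move=> /andP[nz2 nz3] /andP[nz4 nz5].
by rewrite /wp_term /wp_cert; field; rewrite nz0 nz1 nz3 nz4 nz5.
Qed.

Lemma gauss_termE (F : fieldType) (q x : F) (n : nat) :
  1 - x != 0 -> qpoch q q n != 0 -> qpoch (x * q) q n != 0 ->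
  gauss_term q x n =
  (- x) ^+ n * (((1 - x) * qpoch q (q ^+ 2) n)
                / (qpoch q q n * qpoch x q n.+1)).
Proof.
by move=> nz0 nz1 nz2; rewrite /gauss_term qpochSl; field; rewrite nz0 nz1 nz2.
Qed.

(** Expand the fraction by (x)_n (- x)_n = (x^2|q^2)_n. The right side involves base q alone, so its
    factors converge to the infinite products of the theorem. *)
Lemma qpoch_quotientE (F : fieldType) (q x : F) (n : nat) :
  qpoch (x ^+ 2) q (2 * n) != 0 ->
  qpoch (x * q) q n * qpoch (- x) q n / qpoch (x ^+ 2 * q) (q ^+ 2) n =
  qpoch x q n * qpoch (x * q) q n * qpoch (- x) q n ^+ 2
    / qpoch (x ^+ 2) q (2 * n).
Proof.
rewrite qpoch_double qpoch_sqr !mulf_eq0 !negb_or.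
move=> /andP[/andP[nz1 nz2] nz3].
by field; rewrite nz1 nz2 nz3.
Qed.

(** Induction on N, the boundary term vanishing at N = 0. The multiplier is the ratio of the claimed
    sum at x to the claimed sum at x q. *)
Lemma wp_sum_rec (F : fieldType) (q x : F) (N : nat) :
  (forall j, 1 - x * q ^+ j != 0) -> (forall j, 1 - q * q ^+ j != 0) ->
  (forall j, 1 - x ^+ 2 * q * (q ^+ 2) ^+ j != 0) ->
  \sum_(n < N) wp_term q x n =
  (1 - x * q) * (1 + x) / (1 - x ^+ 2 * q) * \sum_(n < N) wp_term q (x * q) n
  - (1 - q ^+ N) * wp_cert q x N.
Proof.
move=> nzx nzq nzx2; elim: N => [|N IHN].
  by rewrite !big_ord0 expr0 subrr mulr0 mul0r subr0.
rewrite !big_ord_recr {}IHN /=; set k := _ / _.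
(* The WZ equation for a single term. With all products expressed through those of index N at x, it
   becomes, up to a common factor, an identity of rational functions in x, q and q^N. *)
suff -> : wp_term q x N = k * wp_term q (x * q) N
  + (1 - q ^+ N) * wp_cert q x N - (1 - q ^+ N.+1) * wp_cert q x N.+1 by ring.
rewrite {}/k.
have nz0 : 1 - x != 0 by have := nzx 0%N; rewrite mulr1.
have nz1 : 1 - x * q != 0 by have := nzx 1%N.
have nz2 : 1 - x ^+ 2 * q != 0 by have := nzx2 0%N; rewrite mulr1.
have nzX := nzx N; have nzQ := nzq N; have nzX2 := nzx2 N.
have nzD : qpoch q q N != 0 by apply: qpoch_neq0.
have nzE : qpoch (x ^+ 2 * q) (q ^+ 2) N != 0 by apply: qpoch_neq0.
rewrite /wp_term /wp_cert.
(* The shift from x to x q thus moves the base q^2 product by one factor, and [qpoch_shift] applies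
   to it. *)
have -> : (x * q) ^+ 2 * q = x ^+ 2 * q * q ^+ 2 by ring.
have -> : q ^+ 'C(N.+1, 2) = q ^+ 'C(N, 2) * q ^+ N.
  by rewrite binS bin1 exprD.
rewrite !(qpoch_shift, qpochS) // exprMn.
rewrite [x ^+ N.+1]exprS [q ^+ N.+1]exprS.
have -> : q ^+ (2 * N) = q ^+ N ^+ 2 by rewrite mulnC exprM.
move: nzX2; have -> : (q ^+ 2) ^+ N = q ^+ N ^+ 2 by rewrite -!exprM mulnC.
move=> nzX2.
move: nzX nzQ nzX2 nzD nzE.
set X := q ^+ N; set A := qpoch x q N; set B := qpoch q (q ^+ 2) N.
set D := qpoch q q N; set E := qpoch _ _ N.
set c := q ^+ 'C(N, 2); set y := x ^+ N.
move=> nzX nzQ nzX2 nzD nzE.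
by field; rewrite nzX2 nzE nzQ nzD nz0 nz2 nz1.
Qed.

(** The telescoping of [wp_sum_rec] with the reciprocal multiplier, since the second claimed sum is
    the reciprocal of the first. *)
Lemma gauss_sum_rec (F : fieldType) (q x : F) (N : nat) :
  1 + x != 0 ->
  (forall j, 1 - x * q * q ^+ j != 0) -> (forall j, 1 - q * q ^+ j != 0) ->
  \sum_(n < N) gauss_term q x n =
  (1 - x ^+ 2 * q) / ((1 - x * q) * (1 + x))
    * \sum_(n < N) gauss_term q (x * q) n
  - (1 - q ^+ N) / (1 + x) * gauss_term q x N.
Proof.
move=> nz0 nzx nzq; elim: N => [|N IHN].
  by rewrite !big_ord0 expr0 subrr mulr0 !mul0r subr0.
rewrite !big_ord_recr {}IHN /=; set k := (1 - x ^+ 2 * q) / _.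
suff step : gauss_term q x N = k * gauss_term q (x * q) N
  + (1 - q ^+ N) / (1 + x) * gauss_term q x N
  - (1 - q ^+ N.+1) / (1 + x) * gauss_term q x N.+1 by rewrite {2}step; ring.
rewrite {}/k.
have nz1 : 1 - x * q != 0 by have := nzx 0%N; rewrite mulr1.
have nzX := nzx N; have nzQ := nzq N.
have nzD : qpoch q q N != 0 by apply: qpoch_neq0.
have nzE : qpoch (x * q) q N != 0 by apply: qpoch_neq0.
rewrite /gauss_term !qpochS (qpoch_shift _ _ nz1) -[- (x * q)]mulNr.
rewrite [(- x * q) ^+ N]exprMn [(- x) ^+ N.+1]exprS [q ^+ N.+1]exprS.
have -> : (q ^+ 2) ^+ N = q ^+ N ^+ 2 by rewrite -!exprM mulnC.
move: nzX nzQ nzD nzE.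
set X := q ^+ N; set B := qpoch q (q ^+ 2) N.
set D := qpoch q q N; set E := qpoch _ _ N; set y := (- x) ^+ N.
move=> nzX nzQ nzD nzE.
by field; rewrite nzX nzE nzQ nzD nz0 mulNr nz1.
Qed.

(** * Iterating a recurrence in x *)

Lemma sum_geometric_le (K : numFieldType) (r : K) (m : nat) :
  0 <= r -> r < 1 -> \sum_(i < m) r ^+ i <= (1 - r)^-1.
Proof.
move=> r0 r1; have r1' : 0 < 1 - r by rewrite subr_gt0.
rewrite -[leRHS]mul1r ler_pdivlMr // mulrC -opprB mulNr -subrX1 opprB.
by rewrite gerBl exprn_ge0.
Qed.

(** Common to both series: [t] is the summand, [g] the boundary term and [c] the multiplier, with
    one constant [C] for all the bounds. *)
Lemma iterated_qshift_le (K : numFieldType) (q b C : K) (t g : K -> nat -> K)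
    (c : K -> K) :
  `|q| < 1 -> `|b| < 1 ->
  (forall x, `|x| <= `|b| -> t x 0%N = 1) ->
  (forall x n, `|x| <= `|b| -> `|t x n| <= C * `|x| ^+ n) ->
  (forall x n, `|x| <= `|b| -> `|g x n| <= C * `|x| ^+ n) ->
  (forall x N, `|x| <= `|b| ->
     \sum_(n < N) t x n = c x * \sum_(n < N) t (x * q) n - g x N) ->
  (forall m, `|\prod_(i < m) c (b * q ^+ i)| <= C) ->
  forall N, `|\sum_(n < N.+1) t b n - \prod_(i < N.+1) c (b * q ^+ i)|
    <= C ^+ 2 / (1 - `|b|) * `|q| ^+ N + C ^+ 2 / (1 - `|q|) * `|b| ^+ N.
Proof.
move=> q1 b1 t0 tC gC rec PC N.
pose S x n := \sum_(j < n) t x j.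
pose P m := \prod_(i < m) c (b * q ^+ i).
have C0 : 0 <= C := le_trans (normr_ge0 _) (PC 0%N).
have qi1 i : `|q| ^+ i <= 1 by rewrite exprn_ile1 // ltW.
have bq i : `|b * q ^+ i| <= `|b| by rewrite normrM normrX ler_piMr.
have iter m : S b N.+1 = P m * S (b * q ^+ m) N.+1
                         - \sum_(i < m) P i * g (b * q ^+ i) N.+1.
  elim: m => [|m IHm].
    by rewrite /P !big_ord0 expr0 mulr1 mul1r subr0.
  have recS : S (b * q ^+ m) N.+1 =
      c (b * q ^+ m) * S (b * q ^+ m * q) N.+1 - g (b * q ^+ m) N.+1.
    exact: rec.
  have PS : P m.+1 = P m * c (b * q ^+ m) by rewrite /P big_ord_recr.
  by rewrite IHm recS PS big_ord_recr exprSr mulrA /=; ring.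
(* The term of index 0 is 1, and the later ones satisfy |x|^(i+1) <= |x| |b|^i. *)
have S1 x : `|x| <= `|b| -> `|S x N.+1 - 1| <= C / (1 - `|b|) * `|x|.
  move=> xb; rewrite /S big_ord_recl /= t0 // addrC addKr.
  apply: le_trans (ler_norm_sum _ _ _) _.
  apply: (@le_trans _ _ (\sum_(i < N) C * `|x| * `|b| ^+ i)).
    apply: ler_sum => i _; apply: le_trans (tC _ _ xb) _.
    rewrite /= -mulrA ler_wpM2l // /bump /= add1n exprS.
    by rewrite ler_wpM2l // lerXn2r // ?nnegrE.
  rewrite -mulr_sumr [leRHS]mulrAC ler_wpM2l ?mulr_ge0 //.
  exact: sum_geometric_le.
(* As many shifts as terms: the distance of the shifted sum from 1 is then O(|q|^N), and the
   boundary terms together are O(|b|^N). *)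
rewrite -/(S b N.+1) -/(P N.+1) (iter N.+1).
have -> (x y z : K) : x * y - z - x = x * (y - 1) - z by ring.
apply: le_trans (ler_normB _ _) (lerD _ _).
  rewrite normrM expr2 -!mulrA ler_pM ?PC //.
  apply: le_trans (S1 _ (bq _)) _; rewrite -mulrA ler_wpM2l //.
  rewrite ler_wpM2l ?invr_ge0 ?subr_ge0 ?(ltW b1) //.
  rewrite normrM normrX exprS mulrA ler_piMl ?exprn_ge0 //.
  by rewrite mulr_ile1 // ltW.
apply: le_trans (ler_norm_sum _ _ _) _.
(* Here |b q^i|^(N+1) <= |b|^N |q|^i, which leaves a geometric sum in |q|. *)
apply: (@le_trans _ _ (\sum_(i < N.+1) C ^+ 2 * `|b| ^+ N * `|q| ^+ i)).
  apply: ler_sum => i _; rewrite normrM expr2 -!mulrA ler_pM ?PC //.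
  apply: le_trans (gC _ _ (bq _)) _; rewrite ler_wpM2l //.
  rewrite normrM normrX exprMn ler_pM ?exprn_ge0 //.
    by rewrite exprSr ler_piMr ?exprn_ge0 // ltW.
  by rewrite exprSr ler_piMl ?exprn_ge0 // exprn_ile1 ?exprn_ge0.
rewrite -mulr_sumr [leRHS]mulrAC ler_wpM2l ?mulr_ge0 ?exprn_ge0 //.
exact: sum_geometric_le.
Qed.

(** * Bounds for shifted factorials, uniform in their length *)

Lemma prod_geometric_le (R : realType) (k r : R) (n : nat) :
  0 <= k -> 0 <= r -> r < 1 ->
  \prod_(j < n) (1 + k * r ^+ j) <= expR (k / (1 - r)).
Proof.
move=> k0 r0 r1.
apply: (@le_trans _ _ (\prod_(j < n) expR (k * r ^+ j))).
  apply: ler_prod => j _.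
  by rewrite addr_ge0 ?mulr_ge0 ?exprn_ge0 // expR_ge1Dx.
rewrite -expR_sum ler_expR -mulr_sumr ler_wpM2l //.
exact: sum_geometric_le.
Qed.

(** Norms in [R[i]] are themselves elements of [R[i]]; this moves them to [R] for arguments of real
    analysis. *)
Lemma complex_ge0P (R : realType) (z : R[i]) : 0 <= z ->
  exists2 x : R, 0 <= x & z = x%:C.
Proof.
move=> z0; have /complex_realP[x zE] := ger0_real z0.
by exists x => //; rewrite -ler0c -zE.
Qed.

(** Both |1 - a q^j| and its inverse are at most 1 + |q|^j / (1 - r), and the product of these
    majorants is bounded by an exponential. *)
Lemma qpoch_bounded (R : realType) (r q : R[i]) :
  0 <= r -> r < 1 -> `|q| < 1 ->
  exists2 M : R[i], 0 <= M & forall a n, `|a| <= r ->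
    `|qpoch a q n| <= M /\ `|(qpoch a q n)^-1| <= M.
Proof.
move=> r0 r1 q1; have r1' : 0 < 1 - r by rewrite subr_gt0.
have [s s0 sE] := complex_ge0P (normr_ge0 q).
have k0 : 0 <= (1 - r)^-1 by rewrite invr_ge0 ltW.
have [k kR0 kE] := complex_ge0P k0.
exists (expR (k / (1 - s)))%:C; first by rewrite ler0c expR_ge0.
move=> a n ar.
have prodM (f : nat -> R[i]) :
    (forall j, `|f j| <= 1 + (1 - r)^-1 * `|q| ^+ j) ->
    `|\prod_(j < n) f j| <= (expR (k / (1 - s)))%:C.
  move=> fM; rewrite normr_prod.
  apply: (@le_trans _ _ (\prod_(j < n) (1 + k * s ^+ j))%:C); last first.
    by rewrite lecR prod_geometric_le // -ltcR -sE.
  rewrite rmorph_prod; apply: ler_prod => j _; rewrite normr_ge0 /=.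
  by rewrite rmorphD rmorphM rmorphXn rmorph1 /= -sE -kE.
have k1 : 1 <= (1 - r)^-1.
  by rewrite invf_ge1 // gerBl.
have qj j : `|q| ^+ j <= 1 by rewrite exprn_ile1 // ltW.
have aqj j : `|a * q ^+ j| <= r * `|q| ^+ j.
  by rewrite normrM normrX ler_wpM2r ?exprn_ge0.
split.
  apply: (prodM (fun j => 1 - a * q ^+ j)) => j.
  apply: le_trans (ler_normB _ _) _.
  rewrite normr1 lerD2l; apply: le_trans (aqj j) _.
  by rewrite ler_wpM2r ?exprn_ge0 // (le_trans (ltW r1)).
rewrite /qpoch -prodfV; apply: (prodM (fun j => (1 - a * q ^+ j)^-1)) => j.
have lb : 1 - r * `|q| ^+ j <= `|1 - a * q ^+ j|.
  apply: le_trans (lerB_dist _ _); rewrite normr1 lerD2l lerN2.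
  exact: aqj.
have rq1 : r * `|q| ^+ j < 1 by apply: le_lt_trans r1; rewrite ler_piMr.
have lb0 : 0 < 1 - r * `|q| ^+ j by rewrite subr_gt0.
rewrite normfV.
apply: (@le_trans _ _ (1 - r * `|q| ^+ j)^-1).
  by rewrite lef_pV2 // posrE // (lt_le_trans lb0).
rewrite -[leLHS]mul1r ler_pdivrMr //.
set x := `|q| ^+ j.
have x0 : 0 <= x by rewrite exprn_ge0.
(* Writes the product as 1 plus x times a nonnegative quantity: (1 - r)^-1 (1 - r) is left
   uncancelled for [ring], and once it is replaced by 1 it compensates - r. *)
have -> : (1 + (1 - r)^-1 * x) * (1 - r * x) =
    1 + x * ((1 - r)^-1 * (1 - r) * 1 + r * (1 - r)^-1 * (1 - x) - r) by ring.
rewrite mulVf ?gt_eqF // lerDl mulr_ge0 // mulr1 addrAC addr_ge0 //.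
  exact: ltW.
by rewrite !mulr_ge0 // subr_ge0 /x qj.
Qed.

(** * Convergence of complex sequences *)

Lemma cvgn_geometric_increments (R : realType) (v : R ^nat) (M r : R) :
  0 <= r -> r < 1 -> (forall n, `|v n.+1 - v n| <= M * r ^+ n) -> cvgn v.
Proof.
move=> r0 r1 vM.
have cvgS : cvgn (series (fun n => v n.+1 - v n)).
  apply: normed_cvg; apply: (series_le_cvg _ _ vM) => [n|n|] //=.
    exact: le_trans (vM n).
  by apply: is_cvg_geometric_series; rewrite ger0_norm.
have -> : v = (fun n => series (fun n => v n.+1 - v n) n + v 0%N).
  by apply: funext => n; rewrite /series /= telescope_sumr // subrK.
by apply: is_cvgD => //; exact: is_cvg_cst.
Qed.

Lemma cvgn_sub0 (K : numFieldType) (u : nat -> K) (l : K) :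
  (fun n => u n - l : K^o) @ \oo --> (0 : K^o) <->
  (fun n => u n : K^o) @ \oo --> (l : K^o).
Proof. exact: subr_cvg0. Qed.

Lemma normc_le_ReIm (R : realType) (z : R[i]) :
  `|z| <= (`|complex.Re z| + `|complex.Im z|)%:C.
Proof.
have normR (x : R) : `|x%:C| = `|x|%:C.
  by rewrite normc_def /= expr0n addr0 sqrtr_sqr.
rewrite {1}[z]complexE; apply: le_trans (ler_normD _ _) _.
rewrite normrM rmorphD /=.
rewrite (_ : `|'i%C| = 1 :> R[i]) ?mul1r; last first.
  by rewrite normc_def /= expr0n expr1n add0r sqrtr1.
by rewrite !normR.
Qed.

Lemma normc_ge_Im (R : realType) (z : R[i]) : `|complex.Im z|%:C <= `|z|.
Proof.
by rewrite normc_def lecR -sqrtr_sqr ler_wsqrtr // lerDr sqr_ge0.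
Qed.

Lemma cvgn_complex_dominated (R : realType) (u : nat -> R[i]) (v : R ^nat) :
  v @ \oo --> (0 : R) -> (forall n, `|u n| <= (v n)%:C) ->
  (fun n => u n : R[i]^o) @ \oo --> (0 : R[i]^o).
Proof.
move=> v0 uv; apply/cvgr0Pnorm_le => e e0.
have [x x0 eE] := complex_ge0P (ltW e0).
have {}x0 : 0 < x by rewrite -ltcR -eE.
have /cvgr0Pnorm_le/(_ x x0) vx := v0.
near=> n; have vxn : `|v n| <= x by near: n.
by apply: le_trans (uv n) _; rewrite eE lecR (le_trans (ler_norm _)).
Unshelve. all: by end_near.
Qed.

(** Real and imaginary parts have increments under the same geometric bound, so they converge
    separately; their limits are the parts of the complex limit. *)
Lemma cvgn_complex_geometric_increments (R : realType) (u : nat -> R[i])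
    (M q : R[i]) :
  `|q| < 1 -> (forall n, `|u n.+1 - u n| <= M * `|q| ^+ n) ->
  cvg ((fun n => u n : R[i]^o) @ \oo).
Proof.
move=> q1 uM.
have [s s0 sE] := complex_ge0P (normr_ge0 q).
have M0 : 0 <= M by have := uM 0%N; rewrite expr0 mulr1; apply: le_trans.
have [m _ mE] := complex_ge0P M0.
have s1 : s < 1 by rewrite -ltcR -sE.
have {}uM n : `|u n.+1 - u n| <= (m * s ^+ n)%:C.
  by rewrite rmorphM rmorphXn /= -sE -mE.
have cRe : cvgn (fun n => complex.Re (u n)).
  apply: (cvgn_geometric_increments s0 s1) => n.
  rewrite -lecR; apply: le_trans (uM n).
  have -> : complex.Re (u n.+1) - complex.Re (u n) = complex.Re (u n.+1 - u n).
    by case: (u n.+1) (u n) => [? ?] [? ?].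
  exact: normc_ge_Re.
have cIm : cvgn (fun n => complex.Im (u n)).
  apply: (cvgn_geometric_increments s0 s1) => n.
  rewrite -lecR; apply: le_trans (uM n).
  have -> : complex.Im (u n.+1) - complex.Im (u n) = complex.Im (u n.+1 - u n).
    by case: (u n.+1) (u n) => [? ?] [? ?].
  exact: normc_ge_Im.
set a := limn (fun n => complex.Re (u n)) in cRe.
set b := limn (fun n => complex.Im (u n)) in cIm.
have u0 : (fun n => (u n - (a +i* b)) : R[i]^o) @ \oo --> (0 : R[i]^o).
  apply: (@cvgn_complex_dominated R _ (fun n =>
    `|complex.Re (u n) - a| + `|complex.Im (u n) - b|)) => [|n]; last first.
    apply: le_trans (normc_le_ReIm _) _.
    by case: (u n) => x y; rewrite /=.
  rewrite -[0](addr0 (0 : R)); apply: cvgD.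
    by apply/norm_cvg0P/subr_cvg0.
  by apply/norm_cvg0P/subr_cvg0.
apply/cvg_ex; exists (a +i* b : R[i]^o).
exact: (cvgn_sub0 u (a +i* b)).1 u0.
Qed.

Lemma cvgn_complex_expr (R : realType) (q : R[i]) : `|q| < 1 ->
  (fun n => `|q| ^+ n : R[i]^o) @ \oo --> (0 : R[i]^o).
Proof.
move=> q1; have [s s0 sE] := complex_ge0P (normr_ge0 q).
apply: (@cvgn_complex_dominated R _ (fun n => s ^+ n)) => [|n].
  by apply: cvg_expr; rewrite ger0_norm // -ltcR -sE.
by rewrite rmorphXn /= -sE normrX normr_id.
Qed.

(** * Infinite products: existence, nonvanishing, common bounds *)

(** As [qpoch_inf] is defined as a limit, only its existence is at stake: the increments are - (a)_n
    a q^n with (a)_n bounded. *)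
Lemma cvg_qpoch_inf (R : realType) (a q : R[i]) : `|a| < 1 -> `|q| < 1 ->
  (fun n => qpoch a q n : R[i]^o) @ \oo --> (qpoch_inf a q : R[i]^o).
Proof.
move=> a1 q1; have [M M0 aM] := qpoch_bounded (normr_ge0 a) a1 q1.
apply: (@cvgn_complex_geometric_increments R _ M q q1) => n.
rewrite qpochS mulrBr mulr1 addrC addKr normrN !normrM.
have [bM _] := aM a n (lexx _); apply: ler_pM; rewrite ?mulr_ge0 //.
by rewrite normrX ler_piMl ?exprn_ge0 // ltW.
Qed.

Lemma subr1_neq0 (K : numDomainType) (z : K) : `|z| < 1 -> 1 - z != 0.
Proof.
by move=> z1; rewrite subr_eq0; apply: contraTneq z1 => <-; rewrite normr1 ltxx.
Qed.

(** The inverses of the partial products are bounded by M, which keeps these products away from 0;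
    (M + 1)^-1 is a threshold that they cannot go below. *)
Lemma qpoch_inf_neq0 (R : realType) (a q : R[i]) : `|a| < 1 -> `|q| < 1 ->
  qpoch_inf a q != 0.
Proof.
move=> a1 q1; have [M M0 aM] := qpoch_bounded (normr_ge0 a) a1 q1.
apply/eqP => E; have := cvg_qpoch_inf a1 q1; rewrite E.
have M1 : 0 < M + 1 by rewrite ltr_wpDl.
have e0 : 0 < (M + 1)^-1 by rewrite invr_gt0.
move=> /cvgr0Pnorm_le/(_ _ e0) [n _ /(_ n (leqnn n)) /= qn].
have nz : qpoch a q n != 0.
  apply: qpoch_neq0 => j; apply: subr1_neq0.
  by rewrite normrM normrX (le_lt_trans _ a1) // ler_piMr // exprn_ile1 // ltW.
suff : (1 : R[i]) < 1 by rewrite ltxx.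
apply: (@le_lt_trans _ _ ((M + 1)^-1 * M)); last first.
  by rewrite mulrC ltr_pdivrMr // mul1r ltrDl.
have E1 : `|qpoch a q n| * `|(qpoch a q n)^-1| = 1.
  by rewrite -normrM divff // normr1.
by rewrite -[leLHS]E1 ler_pM //; have [] := aM a n (lexx _).
Qed.

(** Sum of the four bounds given by two radii and two bases. The added 1 gives [1 <= M], so that
    trivial factors are bounded by [M] as well. *)
Lemma qpoch_uniformly_bounded (R : realType) (b q : R[i]) :
  `|b| < 1 -> `|q| < 1 ->
  exists2 M : R[i], 1 <= M & forall a n, `|a| <= `|b| \/ `|a| <= `|q| ->
    [/\ `|qpoch a q n| <= M, `|(qpoch a q n)^-1| <= M,
        `|qpoch a (q ^+ 2) n| <= M & `|(qpoch a (q ^+ 2) n)^-1| <= M].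
Proof.
move=> b1 q1.
have q21 : `|q ^+ 2| < 1 by rewrite normrX expr2 mulr_ilt1.
have [M1 M10 H1] := qpoch_bounded (normr_ge0 b) b1 q1.
have [M2 M20 H2] := qpoch_bounded (normr_ge0 q) q1 q1.
have [M3 M30 H3] := qpoch_bounded (normr_ge0 b) b1 q21.
have [M4 M40 H4] := qpoch_bounded (normr_ge0 q) q1 q21.
exists (1 + (M1 + M2) + (M3 + M4)); first by rewrite -addrA lerDl !addr_ge0.
have le1 : M1 <= 1 + (M1 + M2) + (M3 + M4).
  by rewrite addrAC addrCA -addrA lerDl !addr_ge0.
have le2 : M2 <= 1 + (M1 + M2) + (M3 + M4).
  by rewrite [M1 + M2]addrC addrAC addrCA -addrA lerDl !addr_ge0.
have le3 : M3 <= 1 + (M1 + M2) + (M3 + M4).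
  by rewrite addrCA lerDl !addr_ge0.
have le4 : M4 <= 1 + (M1 + M2) + (M3 + M4).
  by rewrite [M3 + M4]addrC addrCA lerDl !addr_ge0.
move=> a n [ab|aq].
  have [? ?] := H1 a n ab; have [? ?] := H3 a n ab.
  by split; [apply: le_trans le1|apply: le_trans le1
            |apply: le_trans le3|apply: le_trans le3].
have [? ?] := H2 a n aq; have [? ?] := H4 a n aq.
by split; [apply: le_trans le2|apply: le_trans le2
          |apply: le_trans le4|apply: le_trans le4].
Qed.

(** * From the estimate to the limits *)

Lemma cvg_series_iterate (K : numFieldType) (f P : nat -> K) (A B q b L : K) :
  (fun n => `|q| ^+ n : K^o) @ \oo --> (0 : K^o) ->
  (fun n => `|b| ^+ n : K^o) @ \oo --> (0 : K^o) ->
  (forall N, `|\sum_(n < N.+1) f n - P N.+1|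
             <= A * `|q| ^+ N + B * `|b| ^+ N) ->
  (fun n => P n : K^o) @ \oo --> (L : K^o) ->
  series (fun n => f n : K^o) @ \oo --> (L : K^o).
Proof.
move=> q1 b1 fP PL.
have w0 : (fun n => A * `|q| ^+ n + B * `|b| ^+ n : K^o) @ \oo
    --> (0 : K^o).
  rewrite -[0](addr0 (0 : K^o)); apply: cvgD.
    rewrite -[0](mulr0 A); apply: cvgM; first exact: cvg_cst.
    by [].
  rewrite -[0](mulr0 B); apply: cvgM; first exact: cvg_cst.
  by [].
(* The estimate compares sums and products of N + 1 terms, hence the shift of both sequences. *)
move: PL; rewrite -cvg_shiftS => PL; rewrite -cvg_shiftS.
have d0 : (fun n => \sum_(k < n.+1) f k - P n.+1 : K^o) @ \oo --> (0 : K^o).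
  apply/cvgr0Pnorm_le => e e0.
  have /cvgr0Pnorm_le/(_ _ e0) we := w0.
  near=> n.
  have wn : `|A * `|q| ^+ n + B * `|b| ^+ n| <= e by near: n.
  (* No sign is assumed for [A] and [B]; the bound is nonnegative because it dominates a norm. *)
  rewrite ger0_norm in wn; last exact: le_trans (normr_ge0 _) (fP n).
  exact: le_trans (fP n) wn.
have E : (fun n => series (fun n => f n : K^o) n.+1) =
    (fun n => (\sum_(k < n.+1) f k - P n.+1) + P n.+1 : K^o).
  by apply: funext => n; rewrite /series /= big_mkord subrK.
rewrite E -[L]add0r; exact: cvgD d0 PL.
Unshelve. all: by end_near.
Qed.

Lemma cvgn_quotient (K : numFieldType) (u v w z : nat -> K) (a b c d : K) :
  d != 0 ->
  (fun n => u n : K^o) @ \oo --> (a : K^o) ->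
  (fun n => v n : K^o) @ \oo --> (b : K^o) ->
  (fun n => w n : K^o) @ \oo --> (c : K^o) ->
  (fun n => z n : K^o) @ \oo --> (d : K^o) ->
  (fun n => u n * v n * w n ^+ 2 / z n : K^o) @ \oo
  --> (a * b * c ^+ 2 / d : K^o).
Proof.
move=> nzd ua vb wc zd; apply: cvgM; last exact: cvgV.
by apply: cvgM; apply: cvgM.
Qed.

Lemma cvgn_inv (K : numFieldType) (u : nat -> K) (l : K) : l != 0 ->
  (fun n => u n : K^o) @ \oo --> (l : K^o) ->
  (fun n => (u n)^-1 : K^o) @ \oo --> (l^-1 : K^o).
Proof. by move=> nzl ul; apply: cvgV. Qed.

Lemma cvgn_double (K : numFieldType) (u : nat -> K) (l : K) :
  (fun n => u n : K^o) @ \oo --> (l : K^o) ->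
  (fun n => u (2 * n)%N : K^o) @ \oo --> (l : K^o).
Proof. by move=> ul; apply: (cvg_comp (muln 2)) ul; apply: cvg_mulnl. Qed.

(** After [qpoch_quotientE] each factor is a base q product, and the denominator runs through the
    even-index subsequence of one. *)
Lemma cvg_euler_quotient (R : realType) (q b : R[i]) : `|b| < 1 -> `|q| < 1 ->
  (fun n => qpoch (b * q) q n * qpoch (- b) q n
            / qpoch (b ^+ 2 * q) (q ^+ 2) n : R[i]^o) @ \oo
  --> (qpoch_inf b q * qpoch_inf (b * q) q * qpoch_inf (- b) q ^+ 2
       / qpoch_inf (b ^+ 2) q : R[i]^o).
Proof.
move=> b1 q1.
have qj j : `|q| ^+ j <= 1 by rewrite exprn_ile1 // ltW.
have nb1 : `|- b| < 1 by rewrite normrN.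
have bq1 : `|b * q| < 1 by rewrite normrM mulr_ilt1.
have b21 : `|b ^+ 2| < 1 by rewrite normrX expr2 mulr_ilt1.
have nz a n : `|a| < 1 -> qpoch a q n != 0.
  move=> a1; apply: qpoch_neq0 => j; apply: subr1_neq0.
  by rewrite normrM normrX (le_lt_trans _ a1) // ler_piMr.
have -> : (fun n => qpoch (b * q) q n * qpoch (- b) q n
              / qpoch (b ^+ 2 * q) (q ^+ 2) n : R[i]^o) =
    (fun n => qpoch b q n * qpoch (b * q) q n
              * qpoch (- b) q n ^+ 2
              / qpoch (b ^+ 2) q (2 * n) : R[i]^o).
  by apply: funext => n; apply/qpoch_quotientE/nz.
apply: cvgn_quotient; try exact: cvg_qpoch_inf.
  exact: qpoch_inf_neq0.
exact: (cvgn_double (cvg_qpoch_inf b21 q1)).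
Qed.

Lemma prod_quotient_euler (F : fieldType) (q b : F) (m : nat) :
  \prod_(i < m) ((1 - b * q ^+ i * q) * (1 + b * q ^+ i)
                 / (1 - (b * q ^+ i) ^+ 2 * q)) =
  qpoch (b * q) q m * qpoch (- b) q m / qpoch (b ^+ 2 * q) (q ^+ 2) m.
Proof.
rewrite big_split /= prodfV big_split /=; congr (_ * _ / _).
- by apply: eq_bigr => i _; rewrite mulrAC.
- by apply: eq_bigr => i _; rewrite mulNr opprK.
- by apply: eq_bigr => i _; rewrite exprMn -!exprM mulnC mulrAC.
Qed.

(** * Convergence of the two series *)

Lemma normr_quotient_le (K : numFieldType) (M a b c d e : K) :
  `|a| <= M -> `|b| <= M -> `|c^-1| <= M -> `|d^-1| <= M -> `|e^-1| <= M ->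
  `|a * b / (c * d * e)| <= M ^+ 5.
Proof.
move=> aM bM cM dM eM; rewrite !invfM !mulrA !normrM 4!exprSr expr1.
by rewrite !ler_pM ?mulr_ge0.
Qed.

Lemma normr_subr1X_le (K : numDomainType) (q x : K) (n : nat) :
  `|q| <= 1 -> `|x| <= 1 -> `|1 - x * q ^+ n| <= 2%:R.
Proof.
move=> q1 x1; apply: le_trans (ler_normB _ _) _.
by rewrite normr1 lerD2l normrM normrX mulr_ile1 // ?exprn_ge0 // exprn_ile1.
Qed.

Lemma cvg_wp_series (R : realType) (q b : R[i]) : `|b| < 1 -> `|q| < 1 ->
  series (fun n => wp_term q b n : R[i]^o) @ \oo
  --> (qpoch_inf b q * qpoch_inf (b * q) q * qpoch_inf (- b) q ^+ 2
       / qpoch_inf (b ^+ 2) q : R[i]^o).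
Proof.
move=> b1 q1; have [M M1 qpM] := qpoch_uniformly_bounded b1 q1.
have M0 : 0 <= M := le_trans ler01 M1.
have qj j : `|q| ^+ j <= 1 by rewrite exprn_ile1 // ltW.
have x1 (x : R[i]) : `|x| <= `|b| -> `|x| < 1 by move/le_lt_trans; apply.
have bqb (x : R[i]) : `|x| <= `|b| -> `|x * q| <= `|b|.
  by move=> xb; rewrite normrM (le_trans _ xb) // ler_piMr // ltW.
have nbb (x : R[i]) : `|x| <= `|b| -> `|- x| <= `|b| by rewrite normrN.
have x2qb (x : R[i]) : `|x| <= `|b| -> `|x ^+ 2 * q| <= `|b|.
  move=> xb; rewrite normrM normrX expr2 -mulrA (le_trans _ xb) //.
  by rewrite ler_piMr // mulr_ile1 // ltW // x1.
have nz (x : R[i]) j : `|x| < 1 -> 1 - x * q ^+ j != 0.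
  move=> {}x1; apply: subr1_neq0.
  by rewrite normrM normrX (le_lt_trans _ x1) // ler_piMr.
have certM x n : `|x| <= `|b| -> `|wp_cert q x n| <= M ^+ 5 * `|x| ^+ n.
  move=> xb; have [A1 _ _ _] := qpM x n (or_introl xb).
  (* Length 1, because 1 - x = (x)_1. *)
  have [_ A2 _ _] := qpM x 1%N (or_introl xb).
  have [_ A3 A4 _] := qpM q n (or_intror (lexx _)).
  have [_ _ _ A5] := qpM (x ^+ 2 * q) n (or_introl (x2qb _ xb)).
  rewrite qpochS qpoch0 mul1r expr0 mulr1 in A2.
  have tM := normr_quotient_le A1 A4 A2 A3 A5.
  rewrite /wp_cert normrM [leRHS]mulrC ler_pM //.
  by rewrite normrM !normrX ler_piMr ?exprn_ge0.
have M5 (z w y : R[i]) (n : nat) : `|z| <= 2%:R -> `|w| <= M ^+ 5 * `|y| ^+ n ->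
    `|z * w| <= 2%:R * M ^+ 5 * `|y| ^+ n.
  by move=> z2 wM; rewrite normrM -[leRHS]mulrA ler_pM.
apply: (cvg_series_iterate (cvgn_complex_expr q1) (cvgn_complex_expr b1) _
  (cvg_euler_quotient b1 q1)) => N.
rewrite -prod_quotient_euler.
(* The 2 bounds both 1 - x q^(2n) in the summand and 1 - q^n in the boundary term; M^5 counts the
   five factors of [wp_cert]. *)
apply: (@iterated_qshift_le _ _ _ (2%:R * M ^+ 5) (wp_term q)
  (fun x n => (1 - q ^+ n) * wp_cert q x n)
  (fun x => (1 - x * q) * (1 + x) / (1 - x ^+ 2 * q)))
  => // [x xb|x n xb|x n xb|x n xb|m].
- rewrite /wp_term /wp_cert !qpoch0 /= !expr0 !mulr1 !mul1r mulVf //.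
  by rewrite -[x in 1 - x]mulr1 -(expr0 q) nz ?x1.
- rewrite /wp_term mulrC; apply: M5 (certM _ _ xb).
  by rewrite normr_subr1X_le // ltW // x1.
- apply: M5 (certM _ _ xb).
  by rewrite -[q ^+ n]mul1r normr_subr1X_le ?normr1 // ltW.
- apply: wp_sum_rec => j; [exact/nz/x1|exact: nz|].
  apply: subr1_neq0; rewrite -exprM normrM normrX.
  by rewrite (le_lt_trans _ b1) // (le_trans _ (x2qb _ xb)) // ler_piMr.
rewrite prod_quotient_euler.
have [A1 _ _ _] := qpM (b * q) m (or_introl (bqb _ (lexx _))).
have [A2 _ _ _] := qpM (- b) m (or_introl (nbb _ (lexx _))).
have [_ _ _ A3] := qpM (b ^+ 2 * q) m (or_introl (x2qb _ (lexx _))).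
(* Unit denominators pad the quotient to the shape of [normr_quotient_le]. *)
have A4 : `|1^-1 : R[i]| <= M by rewrite invr1 normr1.
have := normr_quotient_le A1 A2 A4 A4 A3; rewrite !mul1r => /le_trans; apply.
by rewrite ler_peMl ?exprn_ge0 // ler1n.
Qed.

Lemma cvg_gauss_series (R : realType) (q b : R[i]) : `|b| < 1 -> `|q| < 1 ->
  series (fun n => gauss_term q b n : R[i]^o) @ \oo
  --> (qpoch_inf (b ^+ 2) q
       / (qpoch_inf b q * qpoch_inf (b * q) q
          * qpoch_inf (- b) q ^+ 2) : R[i]^o).
Proof.
move=> b1 q1; have [M M1 qpM] := qpoch_uniformly_bounded b1 q1.
have M0 : 0 <= M := le_trans ler01 M1.
have qj j : `|q| ^+ j <= 1 by rewrite exprn_ile1 // ltW.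
have x1 (x : R[i]) : `|x| <= `|b| -> `|x| < 1 by move/le_lt_trans; apply.
have bqb (x : R[i]) : `|x| <= `|b| -> `|x * q| <= `|b|.
  by move=> xb; rewrite normrM (le_trans _ xb) // ler_piMr // ltW.
have nbb (x : R[i]) : `|x| <= `|b| -> `|- x| <= `|b| by rewrite normrN.
have x2qb (x : R[i]) : `|x| <= `|b| -> `|x ^+ 2 * q| <= `|b|.
  move=> xb; rewrite normrM normrX expr2 -mulrA (le_trans _ xb) //.
  by rewrite ler_piMr // mulr_ile1 // ltW // x1.
have nz (x : R[i]) j : `|x| < 1 -> 1 - x * q ^+ j != 0.
  move=> {}x1; apply: subr1_neq0.
  by rewrite normrM normrX (le_lt_trans _ x1) // ler_piMr.
have termM x n : `|x| <= `|b| -> `|gauss_term q x n| <= M ^+ 5 * `|x| ^+ n.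
  move=> xb; have [_ A2 _ _] := qpM (x * q) n (or_introl (bqb _ xb)).
  have [_ A3 A4 _] := qpM q n (or_intror (lexx _)).
  (* The empty product (q)_0 = 1 fills the spare places of the five-factor bound. *)
  have [A5 A6 _ _] := qpM q 0%N (or_intror (lexx _)).
  have := normr_quotient_le A4 A5 A3 A2 A6; rewrite !qpoch0 !mulr1 => tM.
  by rewrite /gauss_term normrM normrX normrN [leRHS]mulrC ler_pM.
have V1M x : `|x| <= `|b| -> `|(1 + x)^-1| <= M.
  move=> xb; have [_ + _ _] := qpM (- x) 1%N (or_introl (nbb _ xb)).
  by rewrite qpochS qpoch0 mul1r expr0 mulr1 opprK.
have PL : (fun n => (qpoch (b * q) q n * qpoch (- b) q n
              / qpoch (b ^+ 2 * q) (q ^+ 2) n)^-1 : R[i]^o) @ \oo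
  --> ((qpoch_inf b q * qpoch_inf (b * q) q * qpoch_inf (- b) q ^+ 2
       / qpoch_inf (b ^+ 2) q)^-1 : R[i]^o).
  (* Inverting the limit relies on the infinite products being nonzero. *)
  apply: cvgn_inv (cvg_euler_quotient b1 q1).
  rewrite !mulf_neq0 ?invr_eq0 ?expf_neq0 ?qpoch_inf_neq0 ?normrN //.
    by rewrite (le_lt_trans (bqb _ (lexx _))).
  by rewrite normrX expr2 mulr_ilt1.
rewrite invf_div in PL.
have M56 : M ^+ 5 <= 2%:R * M ^+ 6.
  apply: (@le_trans _ _ (2%:R * M ^+ 5)).
    by rewrite ler_peMl ?exprn_ge0 ?ler1n.
  by rewrite [M ^+ 6]exprSr mulrA ler_peMr // mulr_ge0 ?exprn_ge0.
apply: (cvg_series_iterate (cvgn_complex_expr q1) (cvgn_complex_expr b1) _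
  PL) => N.
rewrite -prod_quotient_euler -prodfV.
(* In the boundary term 1 - q^n costs the 2, (1 + x)^-1 one M, and the summand M^5. *)
apply: (@iterated_qshift_le _ _ _ (2%:R * M ^+ 6) (gauss_term q)
  (fun x n => (1 - q ^+ n) / (1 + x) * gauss_term q x n)
  (fun x => ((1 - x * q) * (1 + x) / (1 - x ^+ 2 * q))^-1))
  => // [x xb|x n xb|x n xb|x n xb|m].
- by rewrite /gauss_term !qpoch0 expr0 mulr1 mul1r divr1.
- by apply: le_trans (termM _ _ xb) _; rewrite ler_wpM2r ?exprn_ge0.
- have -> : 2%:R * M ^+ 6 * `|x| ^+ n = 2%:R * M * (M ^+ 5 * `|x| ^+ n).
    by rewrite exprS !mulrA.
  rewrite normrM ler_pM ?termM // normrM ler_pM ?V1M //.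
  by rewrite -[q ^+ n]mul1r normr_subr1X_le ?normr1 // ltW.
- rewrite invf_div; apply: gauss_sum_rec => [|j|j].
  + by rewrite -[x]opprK subr1_neq0 // normrN x1.
  + by apply: nz; rewrite (le_lt_trans (bqb _ xb)).
  + exact: nz.
rewrite prodfV prod_quotient_euler invf_div.
have [_ A1 _ _] := qpM (b * q) m (or_introl (bqb _ (lexx _))).
have [_ A2 _ _] := qpM (- b) m (or_introl (nbb _ (lexx _))).
have [_ _ A3 _] := qpM (b ^+ 2 * q) m (or_introl (x2qb _ (lexx _))).
have A4 : `|1 : R[i]| <= M by rewrite normr1.
have A5 : `|1^-1 : R[i]| <= M by rewrite invr1 normr1.
have := normr_quotient_le A3 A4 A1 A2 A5; rewrite !mulr1 => /le_trans; exact.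
Qed.

(** * Assembly of the five identities *)

Theorem theorem5 (R : realType) :
  (forall (n : nat) (q beta : R[i]),
     (1 <= n)%N ->
     (forall j : nat, q ^+ j != 0 -> beta != q ^- j) ->
     [/\ 0 = \sum_(k < n.+1)
               (-1) ^+ k * q ^+ 'C(k, 2) * qbinom q n k
               * qpoch (beta * q ^+ (n - k)) q (n - 1),
         0 = \sum_(k < n.+1)
               (-1) ^+ k * q ^+ 'C(k, 2) * qbinom q n k
               * ((1 - beta * q ^+ (2 * k)) / qpoch (beta * q ^+ k) q n.+1)
       & beta != 0 ->
         0 = \sum_(j < n.+1)
               qbinom q n j * qpoch beta q j
               * beta ^+ (n - j) * qpoch beta^-1 q (n - j)])
  /\
  (forall q beta : R[i],
     `|beta| < 1 -> `|q| < 1 ->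
     (series (fun n : nat =>
        beta ^+ n * q ^+ 'C(n, 2)
        * ((qpoch beta q n * (1 - beta * q ^+ (2 * n))
            * qpoch q q (2 * n) * qpoch (beta ^+ 2) (q ^+ 2) n)
           / (qpoch q q n * qpoch (beta ^+ 2) q (2 * n)
              * (1 - beta) * qpoch (q ^+ 2) (q ^+ 2) n)) : R[i]^o) @ \oo
      --> (qpoch_inf beta q * qpoch_inf (beta * q) q
           * qpoch_inf (- beta) q ^+ 2
           / qpoch_inf (beta ^+ 2) q : R[i]^o))
     /\
     (series (fun n : nat =>
        (- beta) ^+ n
        * (((1 - beta) * qpoch q (q ^+ 2) n)
           / (qpoch q q n * qpoch beta q n.+1)) : R[i]^o) @ \oo
      --> (qpoch_inf (beta ^+ 2) q
           / (qpoch_inf beta q * qpoch_inf (beta * q) q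
              * qpoch_inf (- beta) q ^+ 2) : R[i]^o))).
Proof.
split=> [n q beta n1 betaN|q beta beta1 q1].
  (* If q^j = 0 the factor is 1; otherwise its vanishing would make beta the excluded value q^-j. *)
  have nz j : 1 - beta * q ^+ j != 0.
    rewrite subr_eq0; have [->|nzq] := eqVneq (q ^+ j) 0.
      by rewrite mulr0 oner_eq0.
    apply: contra (betaN j nzq) => /eqP E.
    by apply/eqP; rewrite -[LHS](mulfK nzq) -E mul1r.
  (* With n = m + 1, the closed forms of the last two sums are evaluated at K = m + 1, where
     [m, m + 1] = 0. *)
  case: n n1 => // m _; split=> [||nzb].
  - by rewrite subn1 qbinom_alt_qpoch_sum.
  - by rewrite qbinom_wellpoised_partial_sum // qbinom_small // mulr0 mul0r.
  under eq_bigr => j _ do rewrite -mulrA exprM_qpochV //.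
  by rewrite qbinom_qpoch_partial_sum // qbinom_small // !mul0r.
have nz a n : `|a| < 1 -> qpoch a q n != 0.
  move=> a1; apply: qpoch_neq0 => j; apply: subr1_neq0.
  by rewrite normrM normrX (le_lt_trans _ a1) // ler_piMr // exprn_ile1 // ltW.
have nzb : 1 - beta != 0 by apply: subr1_neq0.
have b21 : `|beta ^+ 2| < 1 by rewrite normrX expr2 mulr_ilt1.
split.
  rewrite (_ : (fun n => _) = fun n => wp_term q beta n).
    exact: cvg_wp_series.
  by apply: funext => n; rewrite wp_termE // nz.
rewrite (_ : (fun n => _) = fun n => gauss_term q beta n).
  exact: cvg_gauss_series.
apply: funext => n; rewrite gauss_termE ?nz //.
by rewrite normrM mulr_ilt1.
Qed.
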